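(* Let $d\ge 1$ and $M\ge 1$, and let $|\psi\rangle$ be a core state of $M$ modes containing at most $d$ photons, whose stellar polynomial $P_\psi\in\mathbb{C}[x_1,\dots,x_M]$ has degree $d$. Let $r$ be the Waring rank of the homogenization $P_\psi^h$ of $P_\psi$. Then $|\psi\rangle$ can be prepared exactly (up to a nonzero scalar) from the vacuum state of $M+2$ modes (the $M$ target modes and two ancillary modes in the vacuum) using: $d\,r$ photon additions and $d\,r$ multiport interferometers, applied alternately; then one photon-number projection of the first ancillary mode onto the Fock state with $d(r-1)$ photons; and, additionally, in case $P_\psi$ is not homogeneous, one displacement of the second ancillary mode followed by one projection of that mode onto the state with zero photons.
   Context: Modes and states. Each bosonic mode $j$ has creation/annihilation operators $\hat a_j^\dagger,\hat a_j$ with $[\hat a_j,\hat a_k^\dagger]=\delta_{jk}$; $|\mathbf 0\rangle$ is the multimode vacuum and $|n\rangle=(\hat a^\dagger)^n|0\rangle/\sqrt{n!}$. A core state of $M$ modes is a nonzero vector with finite support in the Fock basis, $|\psi\rangle=\sum_{\mathbf n}\psi_{\mathbf n}|\mathbf n\rangle$. Its stellar polynomial is $P_\psi(\mathbf x)=\sum_{\mathbf n}\frac{\psi_{\mathbf n}}{\sqrt{\mathbf n!}}\mathbf x^{\mathbf n}$, so that $|\psi\rangle=P_\psi(\hat a_1^\dagger,\dots,\hat a_M^\dagger)|\mathbf 0\rangle$. Normalization factors are ignored: states are considered up to nonzero scalars. Operations. Photon addition on mode $j$: $|\phi\rangle\mapsto\hat a_j^\dagger|\phi\rangle$. Multiport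 interferometer: a unitary on Fock space fixing the vacuum and acting by a unitary matrix $V$ as $\hat a_j^\dagger\mapsto\sum_k V_{kj}\hat a_k^\dagger$ (possibly on all modes, including ancillary ones). Projection of mode $j$ onto $n$ photons: $|\phi\rangle\mapsto\langle n|_j|\phi\rangle$ (a vector of the remaining modes; on stellar polynomials this is, up to a constant, $\frac{\partial^n}{\partial x_j^n}P|_{x_j=0}$). Displacement on mode $j$: $\hat D_j(\beta)=\exp(\beta\hat a_j^\dagger-\beta^*\hat a_j)$, $\beta\in\mathbb C$. Homogenization: for $P=\sum_{\mathbf n}p_{\mathbf n}\mathbf x^{\mathbf n}$ of degree $d$, $P^h(y,\mathbf x)=\sum_{\mathbf n}p_{\mathbf n}y^{d-|\mathbf n|}\mathbf x^{\mathbf n}$, homogeneous of degree $d$ in $M+1$ variables (if $P$ is homogeneous, $P^h=P$). The mode associated with $y$ is the second ancillary mode. Waring rank: for a homogeneous polynomial $Q$ of degree $d$ in the variables $\mathbf y$, the least $r$ such that $Q(\mathbf y)=\sum_{k=1}^r(\mathbf w_k^T\mathbf y)^d$ for some complex vectors $\mathbf w_k$. *)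

(* Defs.v *)
From HB Require Import structures.
From mathcomp Require Import all_boot all_order all_algebra.
(* mpoly has to be imported before mathcomp-classical: the notations of the two
   libraries are incompatible in the other order. *)
From mathcomp Require Import mpoly complex.
From mathcomp Require Import boolp classical_sets cardinality fsbigop reals.
From mathcomp Require Import constructive_ereal ereal esum topology.

Set Implicit Arguments.
Unset Strict Implicit.
Unset Printing Implicit Defensive.

Import Order.TTheory GRing.Theory Num.Theory.
Local Open Scope classical_set_scope.
Local Open Scope ring_scope.

(* Amplitude families n |-> <n|phi> in the Fock basis of m modes. The Fock space
   itself consists of the square-summable ones, see [in_fock]. The unbounded
   operators below are given by their matrix elements, which makes them total on
   amplitude families. *)
Definition amp (R : realType) (m : nat) : Type := 'X_{1..m} -> R[i].

Definition sqnorm (R : realType) (m : nat) (phi : amp R m) : \bar R :=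
  \esum_(n in [set: 'X_{1..m}]) (complex.Re (phi n) ^+ 2 + complex.Im (phi n) ^+ 2)%:E.

Definition in_fock (R : realType) (m : nat) (phi : amp R m) : Prop :=
  (sqnorm phi < +oo)%E.

Definition core_state (R : realType) (m : nat) (psi : amp R m) : Prop :=
  finite_set [set n | psi n != 0] /\ exists n, psi n != 0.

Definition vacuum (R : realType) (m : nat) : amp R m :=
  fun n => if n == 0%MM then 1 else 0.
Arguments vacuum : clear implicits.

(* Raising operator of mode j: <n|a_j^dagger phi> = sqrt(n_j) <n - e_j|phi>. *)
Definition creation (R : realType) (m : nat) (j : 'I_m) (phi : amp R m) :
    amp R m :=
  fun n => sqrtC (n j)%:R * phi (n - U_(j))%MM.

(* Lowering operator of mode j: <n|a_j phi> = sqrt(n_j + 1) <n + e_j|phi>. *)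
Definition annihilation (R : realType) (m : nat) (j : 'I_m) (phi : amp R m) :
    amp R m :=
  fun n => sqrtC (n j).+1%:R * phi (n + U_(j))%MM.

Definition proportional (R : realType) (m : nat) (phi chi : amp R m) : Prop :=
  exists2 c : R[i], c != 0 & forall n, phi n = c * chi n.

Definition fock_unitary (R : realType) (m : nat) (U : amp R m -> amp R m) :
    Prop :=
  [/\ forall phi, in_fock phi -> in_fock (U phi),
      forall (a : R[i]) phi chi, in_fock phi -> in_fock chi ->
        U (fun n => a * phi n + chi n) = (fun n => a * U phi n + U chi n),
      forall phi, in_fock phi -> sqnorm (U phi) = sqnorm phi
    & forall chi, in_fock chi -> exists2 phi, in_fock phi & U phi = chi].

(* The relation U a_j^dagger U^dagger = \sum_k V_kj a_k^dagger is expressed as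
   U a_j^dagger = (\sum_k V_kj a_k^dagger) U on the domain of a_j^dagger. *)
Definition interferometer (R : realType) (m : nat) (U : amp R m -> amp R m) :
    Prop :=
  [/\ fock_unitary U,
      U (vacuum R m) = vacuum R m
    & exists2 V : 'M[R[i]]_m, V \is unitarymx &
        forall (j : 'I_m) (phi : amp R m),
          in_fock phi -> in_fock (creation j phi) ->
          U (creation j phi) =
          (fun n => \sum_(k < m) V k j * creation k (U phi) n)].

(* Starting from phi, K rounds made of a photon addition on mode (j k) followed
   by the operation (U k), for k = 0, ..., K - 1. *)
Fixpoint alternate (R : realType) (m : nat) (j : nat -> 'I_m)
    (U : nat -> amp R m -> amp R m) (K : nat) (phi : amp R m) : amp R m :=
  if K is k.+1 then U k (creation (j k) (alternate j U k phi)) else phi.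

(* Occupation numbers of m.+1 modes: p photons in mode j, n in the others. *)
Definition insert_mode (m : nat) (j : 'I_m.+1) (p : nat) (n : 'X_{1..m}) :
    'X_{1..m.+1} :=
  [multinom (if unlift j i is Some i' then n i' else p) | i < m.+1].

Definition remove_mode (m : nat) (j : 'I_m.+1) (n : 'X_{1..m.+1}) : 'X_{1..m} :=
  [multinom n (lift j i) | i < m].

Definition project (R : realType) (m : nat) (j : 'I_m.+1) (p : nat)
    (phi : amp R m.+1) : amp R m :=
  fun n => phi (insert_mode j p n).

(* phi tensored with a vacuum mode inserted at position j *)
Definition adjoin_vacuum (R : realType) (m : nat) (j : 'I_m.+1)
    (phi : amp R m) : amp R m.+1 :=
  fun n => if n j == 0%N then phi (remove_mode j n) else 0.

Definition displacement_generator (R : realType) (m : nat) (j : 'I_m)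
    (beta : R[i]) (phi : amp R m) : amp R m :=
  fun n => beta * creation j phi n - beta^* * annihilation j phi n.

(* chi = exp(A) phi, the exponential series converging in the norm of the Fock
   space. Finitely supported vectors are analytic vectors of the displacement
   generator, so there this agrees with the unitary given by Stone's theorem. *)
Definition is_exp (R : realType) (m : nat) (A : amp R m -> amp R m)
    (phi chi : amp R m) : Prop :=
  (fun K : nat =>
     sqnorm (fun n => \sum_(k < K) (k`!)%:R^-1 * iter k A phi n - chi n))
    @ \oo --> 0%E.

Definition is_displaced (R : realType) (m : nat) (j : 'I_m) (beta : R[i])
    (phi chi : amp R m) : Prop :=
  is_exp (displacement_generator j beta) phi chi.

Definition mnm_fact (m : nat) (n : 'X_{1..m}) : nat := (\prod_(i < m) (n i)`!)%N.

Definition stellar (R : realType) (m : nat) (psi : amp R m) : {mpoly R[i][m]} :=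
  \sum_(n \in [set: 'X_{1..m}]) (psi n / sqrtC (mnm_fact n)%:R) *: 'X_[n].

(* The homogenizing variable y is variable 0. The degree of P is (msize P).-1. *)
Definition homogenization (R : realType) (m : nat) (P : {mpoly R[i][m]}) :
    {mpoly R[i][m.+1]} :=
  \sum_(n <- msupp P)
    P@_n *: 'X_[insert_mode ord0 ((msize P).-1 - mdeg n)%N n].

Definition waring_decomposable (R : realType) (m d : nat)
    (Q : {mpoly R[i][m]}) (r : nat) : Prop :=
  exists w : 'I_r -> 'I_m -> R[i],
    Q = \sum_(k < r) (\sum_(i < m) w k i *: 'X_i) ^+ d.

Definition is_waring_rank (R : realType) (m d : nat) (Q : {mpoly R[i][m]})
    (r : nat) : Prop :=
  waring_decomposable d Q r /\
  forall s : nat, waring_decomposable d Q s -> (r <= s)%N.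

(* Main.v *)
(* Write P^h as a sum of r powers L_k^d and let z_1, ..., z_d be the roots of
   T^d + 1. The product over k and s of the d r linear forms X_0 - z_s L_k is the
   product over k of X_0^d + L_k^d, whose coefficient of X_0^(d (r - 1)) is P^h. A
   product of linear forms is prepared by alternating additions on mode 0 with
   interferometers, because a_0^dagger conjugated by an interferometer is an
   arbitrary normalized linear form in the creation operators. Finally, A = a - a^dagger
   satisfies [A, a^dagger] = 1, so <0|exp(A) (a^dagger)^p|0> does not depend on p:
   displacing by -1 and projecting onto the vacuum sets the homogenizing variable to 1,
   up to the factor exp(-1/2). *)
Require Import Defs.
From HB Require Import structures.
From mathcomp Require Import all_boot all_order all_algebra.
From mathcomp Require Import ssrcomplements mpoly complex.
From mathcomp Require Import boolp classical_sets cardinality fsbigop reals.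
From mathcomp Require Import constructive_ereal ereal esum topology.
From mathcomp Require Import normedtype sequences.
From mathcomp Require Import zify ring lra.

Set Implicit Arguments.
Unset Strict Implicit.
Unset Printing Implicit Defensive.

Import Order.TTheory GRing.Theory Num.Theory.
Local Open Scope ring_scope.

(** * Linear substitutions in polynomials *)

Section PolynomialSubstitution.
Variables (C : comNzRingType) (m : nat).
Implicit Types (p q : {mpoly C[m]}) (V W : 'M[C]_m).

(** Two infinite-dimensional facts carry most of the work. First, V must be implemented by an
    operator that is unitary on the whole Fock space: substituting V into polynomials preserves
    degrees, so it extends degree by degree to arbitrary amplitude families, and it is isometric
    because the Fock norm is the Bombieri norm of the stellar polynomial. Second, the exponential
    series must converge in norm: starting from degree at most d, k applications of the generator
    cost at most 3^k sqrt((d + k)! / d!), which 1/k! beats. The same estimate gives convergence of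
    each amplitude at a geometric rate, and the final identity compares only these limits. *)

Definition linear_forms V : m.-tuple {mpoly C[m]} :=
  [tuple \sum_(k < m) V k j *: 'X_k | j < m].

Lemma linear_subst_var V j : 'X_j \mPo linear_forms V = \sum_k V k j *: 'X_k.
Proof. by rewrite comp_mpolyXU -tnth_nth tnth_mktuple. Qed.

Lemma linear_subst_homog V (n : 'X_{1..m}) :
  'X_[n] \mPo linear_forms V \is (mdeg n).-homog.
Proof.
rewrite comp_mpolyX mdegE; elim/big_ind2: _ => [|? ? ? ?|i _].
- exact: dhomog1.
- exact: dhomogM.
rewrite -[X in X.-homog]mul1n; apply: dhomogMn; rewrite tnth_mktuple.
by apply: rpred_sum => k _; apply: rpredZ; rewrite dhomogX; apply/eqP/mdeg1.
Qed.

Lemma mpoly_linear_eq (A : lmodType C) (f g : {linear {mpoly C[m]} -> A}) :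
  (forall n, f 'X_[n] = g 'X_[n]) -> f =1 g.
Proof.
move=> fg p; rewrite [p]mpolyE !linear_sum; apply: eq_bigr => n _.
by rewrite !linearZ fg.
Qed.

(** Columns hold the images of the variables, so the substitution made last multiplies on the left,
    as operators do. *)
Lemma linear_substM V W p :
  (p \mPo linear_forms W) \mPo linear_forms V = p \mPo linear_forms (V *m W).
Proof.
pose f : {linear _ -> _} := comp_mpoly (linear_forms V) \o comp_mpoly (linear_forms W).
apply: (mpoly_linear_eq (f := f)) => n /=.
rewrite !comp_mpolyX rmorph_prod; apply: eq_bigr => j _.
rewrite rmorphXn /= !tnth_mktuple linear_sum /=; congr (_ ^+ _).
under eq_bigr do rewrite linearZ /= linear_subst_var scaler_sumr.
rewrite exchange_big; apply: eq_bigr => k _.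
rewrite mxE scaler_suml; apply: eq_bigr => i _.
by rewrite scalerA mulrC.
Qed.

Lemma linear_subst1 p : p \mPo linear_forms 1%:M = p.
Proof.
rewrite -[RHS]comp_mpoly_id; congr (_ \mPo _); apply: eq_from_tnth => j.
rewrite !tnth_mktuple (bigD1 j) //= mxE eqxx scale1r big1 ?addr0 // => i ij.
by rewrite mxE (negbTE ij) scale0r.
Qed.

(** The hypotheses describe a subalgebra containing the variables. This form of induction suits
    multiplicative statements and the Leibniz rule. *)
Lemma mpoly_subalg_ind (P : {mpoly C[m]} -> Prop) :
  P 1 -> (forall j, P 'X_j) -> (forall p q, P p -> P q -> P (p * q)) ->
  (forall a p q, P p -> P q -> P (a *: p + q)) -> forall p, P p.
Proof.
move=> P1 PX PM PD; have P0 : P 0.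
  by rewrite -(addNr 1) -scaleN1r; apply: PD.
apply: mpolyind => // a n p _ _ Pp; apply: PD => //.
rewrite mpolyXE_id; apply: big_ind => // j _.
by elim: (n j) => [|k IH]; [rewrite expr0|rewrite exprS; apply: PM].
Qed.

Lemma mderiv_var (i k : 'I_m) : ('X_i : {mpoly C[m]})^`M(k) = (i == k)%:R.
Proof.
rewrite mderivX mnm1E; case: eqP => [->|_]; last by rewrite scale0r.
by rewrite -[X in (X - _)%MM]add0m addmK mpolyX0 scale1r.
Qed.

Lemma mderiv_linear_subst V k p :
  (p \mPo linear_forms V)^`M(k) = \sum_i V k i *: (p^`M(i) \mPo linear_forms V).
Proof.
elim/mpoly_subalg_ind: p => [|j|x y Dx Dy|a x y Dx Dy].
- rewrite rmorph1 -mpolyC1 mderivC big1 // => i _.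
  by rewrite mderivC linear0 scaler0.
- rewrite linear_subst_var linear_sum /=.
  under eq_bigr do rewrite linearZ /= mderiv_var.
  under [RHS]eq_bigr do rewrite mderiv_var rmorph_nat.
  rewrite (bigD1 k) //= eqxx big1 ?addr0 => [|i /negbTE->]; last by rewrite scaler0.
  rewrite (bigD1 j) //= eqxx big1 ?addr0 // => i; rewrite eq_sym => /negbTE->.
  by rewrite scaler0.
- rewrite rmorphM mderivM /= Dx Dy mulr_suml mulr_sumr -big_split /=.
  apply: eq_bigr => i _; rewrite mderivM linearD /= !rmorphM /= scalerDr.
  by rewrite -scalerAl -scalerAr.
- rewrite linearP /= linearP /= Dx Dy.
  under [RHS]eq_bigr do rewrite linearP /= linearP /= scalerDr scalerA mulrC -scalerA.
  by rewrite big_split /= -scaler_sumr.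
Qed.

End PolynomialSubstitution.

Section MonomialFunctional.
Variables (C : comNzRingType) (m : nat).
Implicit Types (p q : {mpoly C[m]}) (f g : 'X_{1..m} -> C).

(** Multiplying the argument by a variable amounts to shifting f, which is how adjoints of
    multiplications are computed below. *)
Definition monomial_functional f p : C := \sum_(n <- msupp p) p@_n * f n.

Lemma monomial_functionalwE f p k : (msize p <= k)%N ->
  monomial_functional f p = \sum_(n : 'X_{1..m < k}) p@_n * f n.
Proof.
move=> le_pk; rewrite /monomial_functional (big_mksub 'X_{1..m < k}) /=; first last.
- by move=> x /msize_mdeg_lt/leq_trans; apply.
- by rewrite msupp_uniq.
by rewrite big_rmcond //= => i /memN_msupp_eq0 ->; rewrite mul0r.
Qed.

Lemma monomial_functional_is_linear f :
  linear_for *%R (monomial_functional f).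
Proof.
move=> a p q.
pose k := maxn (msize (a *: p + q)) (maxn (msize p) (msize q)).
rewrite !(@monomial_functionalwE f _ k) ?leq_max ?leqnn ?orbT //.
rewrite mulr_sumr -big_split /=; apply: eq_bigr => n _.
by rewrite mcoeffD mcoeffZ mulrDl mulrA.
Qed.
HB.instance Definition _ f := GRing.isLinear.Build C {mpoly C[m]} C *%R
  (monomial_functional f) (monomial_functional_is_linear f).

Lemma monomial_functionalX f n : monomial_functional f 'X_[n] = f n.
Proof. by rewrite /monomial_functional msuppX big_seq1 mcoeffX eqxx mul1r. Qed.

Lemma monomial_functional_varM f j p :
  monomial_functional f ('X_j * p) = monomial_functional (fun n => f (n + U_(j))%MM) p.
Proof.
rewrite [p in LHS]mpolyE mulr_sumr linear_sum; apply: eq_bigr => n _ /=.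
by rewrite -scalerAr linearZ /= -mpolyXD monomial_functionalX addmC.
Qed.

Lemma eq_monomial_functional f g p : f =1 g ->
  monomial_functional f p = monomial_functional g p.
Proof. by move=> fg; apply: eq_bigr => n _; rewrite fg. Qed.

End MonomialFunctional.

(** * The Bombieri inner product and its unitary invariance *)

Section BombieriProduct.
Variables (C : numClosedFieldType) (m : nat).
Implicit Types (p q : {mpoly C[m]}) (V : 'M[C]_m).

Lemma mnm_factU (n : 'X_{1..m}) j :
  mnm_fact (n + U_(j))%MM = ((n j).+1 * mnm_fact n)%N.
Proof.
rewrite /mnm_fact (bigD1 j) //= [in RHS](bigD1 j) //= mnmDE mnm1E eqxx addn1.
rewrite factS mulnA; congr (_ * _)%N; apply: eq_bigr => i ij.
by rewrite mnmDE mnm1E eq_sym (negbTE ij) addn0.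
Qed.

Lemma mnm_fact_gt0 (n : 'X_{1..m}) : (0 < mnm_fact n)%N.
Proof. by rewrite prodn_gt0 // => i; rewrite fact_gt0. Qed.

(* The coefficients of the Bombieri inner product with q. *)
Definition bombieri q (n : 'X_{1..m}) : C := (mnm_fact n)%:R * (q@_n)^*.

(** The factor [(n j).+1] gained by the factorial weight is the one produced by the derivation; this
    is the adjointness of creation and annihilation. *)
Lemma bombieriU q j n : bombieri q (n + U_(j))%MM = bombieri q^`M(j) n.
Proof.
rewrite /bombieri mnm_factU mcoeff_deriv natrM -mulrA mulr_natl rmorphMn /=.
by rewrite mulrnAr.
Qed.

Lemma unitary_col_dot V i j : V \is unitarymx ->
  \sum_k (V k j)^* * V k i = (i == j)%:R.
Proof.
move=> Vu; have /unitarymxP/mulmx1C/matrixP/(_ j i) := Vu.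
rewrite !mxE eq_sym => <-; apply: eq_bigr => k _; by rewrite !mxE.
Qed.

Lemma mcoeff0_linear_subst V q : (q \mPo linear_forms V)@_0%MM = q@_0%MM.
Proof.
elim/mpoly_subalg_ind: q => [|j|x y Dx Dy|a x y Dx Dy].
- by rewrite rmorph1.
- have X0 (i : 'I_m) : ('X_i : {mpoly C[m]})@_0%MM = 0.
    by rewrite mcoeffX -mdeg_eq0 mdeg1.
  by rewrite linear_subst_var linear_sum X0 big1 //= => i _; rewrite mcoeffZ X0 mulr0.
- by rewrite rmorphM !rmorphM /= Dx Dy.
- by rewrite linearP !linearP /= Dx Dy.
Qed.

(* Multiplication by 'X_j is adjoint to the derivation along 'X_j, so that the
   chain rule moves the unitary substitution through one factor at a time. *)
Lemma bombieri_unitary V p q : V \is unitarymx ->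
  monomial_functional (bombieri (q \mPo linear_forms V)) (p \mPo linear_forms V) =
  monomial_functional (bombieri q) p.
Proof.
move=> Vu; rewrite -[p]mulr1.
(* The claim is strengthened so that products compose: multiplication by p preserves the invariance
   for any s, and q is free because each variable replaces it by a derivative. *)
pose good s := forall q, monomial_functional (bombieri (q \mPo linear_forms V))
  (s \mPo linear_forms V) = monomial_functional (bombieri q) s.
suff Hp s : good s -> good (p * s).
  apply: Hp => {}q; rewrite rmorph1 -mpolyX0 !monomial_functionalX.
  by rewrite /bombieri mcoeff0_linear_subst.
elim/mpoly_subalg_ind: p s {q} => [|j|x y Dx Dy|a x y Dx Dy] s gs q.
- by rewrite mul1r; apply: gs.
- rewrite rmorphM /= linear_subst_var mulr_suml linear_sum monomial_functional_varM /=.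
  under eq_bigr do rewrite -scalerAl linearZ /= monomial_functional_varM
    (eq_monomial_functional _ (bombieriU _ _)).
  rewrite (eq_monomial_functional _ (bombieriU _ _)) -gs.
  rewrite /monomial_functional; under eq_bigr do rewrite mulr_sumr.
  rewrite exchange_big; apply: eq_bigr => n _ /=.
  under eq_bigr do rewrite mulrCA; rewrite -mulr_sumr; congr (_ * _).
  under eq_bigr do rewrite mulrCA; rewrite -mulr_sumr; congr (_ * _).
  under eq_bigr do rewrite mderiv_linear_subst raddf_sum rmorph_sum mulr_sumr.
  rewrite exchange_big /=.
  (* Orthonormality of the columns of V collapses the double sum to i = j. *)
  have E i : \sum_k V k j * ((V k i *: (q^`M(i) \mPo linear_forms V))@_n)^* =
      (j == i)%:R * ((q^`M(i) \mPo linear_forms V)@_n)^*.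
    rewrite -(unitary_col_dot j i Vu) mulr_suml; apply: eq_bigr => k _.
    by rewrite mcoeffZ rmorphM mulrA /= [V k j * _]mulrC.
  under eq_bigr do rewrite E.
  rewrite (bigD1 j) //= eqxx mul1r big1 ?addr0 // => i.
  by rewrite eq_sym => /negbTE->; rewrite mul0r.
- by rewrite -mulrA; apply/Dx/Dy.
- rewrite mulrDl -scalerAl linearP !linearP /=; congr (_ * _ + _).
    exact: Dx.
  exact: Dy.
Qed.

End BombieriProduct.
(** * Interferometers as second quantizations *)

Section SumsOverMultiindices.
Variables (R : realType) (m : nat).
Implicit Types f : 'X_{1..m} -> R.

(** Any finite set of multi-indices lies below some total degree, so sums by degree are cofinal
    among the finite sums. *)
Lemma esum_mnm_le f (B : \bar R) : (forall n, 0 <= f n) ->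
  (forall k, ((\sum_(n : 'X_{1..m < k.+1}) f n)%:E <= B)%E) ->
  (\esum_(n in [set: 'X_{1..m}]%classic) (f n)%:E <= B)%E.
Proof.
move=> f0 fB; apply: ge_ereal_sup => _ [X [finX _] <-].
rewrite fsbig_finite //= sumEFin.
pose k := \max_(x <- finmap.enum_fset (fset_set X)) mdeg x.
apply: le_trans (fB k); rewrite lee_fin.
rewrite (big_mksub 'X_{1..m < k.+1}) /=; first last.
- by move=> x xX; rewrite ltnS; apply: leq_bigmax_seq.
- exact: finmap.fset_uniq.
rewrite [leRHS](bigID (fun n : 'X_{1..m < k.+1} => val n \in finmap.enum_fset (fset_set X))).
by rewrite lerDl sumr_ge0.
Qed.

Lemma esum_mnm_ge f k : (forall n, 0 <= f n) ->
  ((\sum_(n : 'X_{1..m < k}) f n)%:E <= \esum_(n in [set: 'X_{1..m}]%classic) (f n)%:E)%E.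
Proof.
move=> f0; apply: esum_ge.
pose r := [seq val i | i <- enum {: 'X_{1..m < k}}].
exists [set` r]%classic; first by split => //; apply: finite_seq.
rewrite -fsbig_seq; last by rewrite map_inj_uniq ?enum_uniq //; apply: val_inj.
by rewrite big_map big_enum /= sumEFin.
Qed.

End SumsOverMultiindices.

Section FockSpace.
Variables (R : realType) (m : nat).
Local Notation C := R[i].
Implicit Types (p q : {mpoly C[m]}) (V W : 'M[C]_m) (phi chi : amp R m).

Definition truncation k phi : {mpoly C[m]} :=
  \sum_(n : 'X_{1..m < k.+1}) (phi n / sqrtC (mnm_fact n)%:R) *: 'X_[n].

(** These are the amplitudes of p(a^dagger)|0>, so [amp_of] inverts [stellar] on core states. *)
Definition amp_of p : amp R m := fun n => sqrtC (mnm_fact n)%:R * p@_n.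

(* The second quantization of V substitutes V into the stellar polynomial; it
   preserves degrees, so a truncation at degree [mdeg n] determines amplitude n. *)
Definition second_quantization V phi : amp R m :=
  fun n => amp_of (truncation (mdeg n) phi \mPo linear_forms V) n.

Lemma eq_amp_of p q n : p@_n = q@_n -> amp_of p n = amp_of q n.
Proof. by rewrite /amp_of => ->. Qed.

Lemma sqrtC_fact_neq0 (n : 'X_{1..m}) : sqrtC (mnm_fact n)%:R != 0 :> C.
Proof. by rewrite sqrtC_eq0 pnatr_eq0 -lt0n mnm_fact_gt0. Qed.

Lemma mcoeff_truncation k phi n :
  (truncation k phi)@_n =
  if (mdeg n <= k)%N then phi n / sqrtC (mnm_fact n)%:R else 0.
Proof.
case: leqP => nk; first exact: (mcoeff_mpoly (fun n => phi n / _)).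
rewrite /truncation linear_sum big1 //= => i _; rewrite mcoeffZ mcoeffX.
case: eqP => [ni|_]; last by rewrite mulr0.
by have := bmdeg i; rewrite ni ltnS leqNgt nk.
Qed.

(** A substituted monomial stays homogeneous of the same degree, so homogeneous components are
    transformed independently. *)
Lemma linear_subst_degree V p q d :
  (forall n, mdeg n = d -> p@_n = q@_n) ->
  forall n, mdeg n = d -> (p \mPo linear_forms V)@_n = (q \mPo linear_forms V)@_n.
Proof.
move=> pq n nd; apply/eqP; rewrite -subr_eq0 -mcoeffB -linearB /=.
have {pq} : forall n, mdeg n = d -> (p - q)@_n = 0.
  by move=> n' n'd; rewrite mcoeffB pq ?subrr.
move: (p - q) => {p q} r r0; rewrite comp_mpolyEX linear_sum big1_seq //= => n' _.
rewrite mcoeffZ; have [/r0->|n'd] := eqVneq (mdeg n') d; first by rewrite mul0r.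
rewrite (dhomog_nemf_coeff (linear_subst_homog V n')) ?mulr0 //.
by rewrite /= nd eq_sym.
Qed.

Lemma truncationE k phi n : (mdeg n <= k)%N ->
  phi n = amp_of (truncation k phi) n.
Proof.
by move=> nk; rewrite /amp_of mcoeff_truncation nk mulrC divfK // sqrtC_fact_neq0.
Qed.

(** The freedom in k serves to compare amplitudes before and after a creation, which raises the
    degree by one. *)
Lemma second_quantizationE V phi k n : (mdeg n <= k)%N ->
  second_quantization V phi n = amp_of (truncation k phi \mPo linear_forms V) n.
Proof.
move=> nk; apply: eq_amp_of; apply: linear_subst_degree (erefl (mdeg n)) => n' n'n.
by rewrite !mcoeff_truncation n'n leqnn nk.
Qed.

Lemma second_quantization_amp_of V p :
  second_quantization V (amp_of p) = amp_of (p \mPo linear_forms V).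
Proof.
apply/funext => n; apply: eq_amp_of.
apply: linear_subst_degree (erefl (mdeg n)) => n' n'n.
by rewrite mcoeff_truncation n'n leqnn /amp_of mulrC mulKf // sqrtC_fact_neq0.
Qed.

Lemma truncation_second_quantization V phi k :
  truncation k (second_quantization V phi) = truncation k phi \mPo linear_forms V.
Proof.
apply/mpolyP => n; rewrite mcoeff_truncation; case: leqP => nk.
  rewrite (second_quantizationE _ _ nk) /amp_of mulrC mulKf //.
  exact: sqrtC_fact_neq0.
apply/esym; transitivity ((0 \mPo linear_forms V)@_n).
  apply: linear_subst_degree (erefl (mdeg n)) => n' n'n.
  by rewrite mcoeff0 mcoeff_truncation n'n leqNgt nk.
by rewrite linear0 mcoeff0.
Qed.

Lemma second_quantizationM V W phi :
  second_quantization V (second_quantization W phi) = second_quantization (V *m W) phi.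
Proof.
apply/funext => n.
rewrite [LHS](second_quantizationE _ _ (leqnn _)) truncation_second_quantization.
by rewrite linear_substM.
Qed.

Lemma second_quantization1 phi : second_quantization 1%:M phi = phi.
Proof.
apply/funext => n; rewrite (second_quantizationE _ _ (leqnn _)) linear_subst1.
by rewrite -truncationE.
Qed.

Lemma truncation_is_linear k (a : C) phi chi :
  truncation k (fun n => a * phi n + chi n) = a *: truncation k phi + truncation k chi.
Proof.
rewrite scaler_sumr -big_split /=; apply: eq_bigr => n _.
by rewrite scalerA -scalerDl mulrDl mulrA.
Qed.

Lemma amp_of_linear (a : C) p q n :
  amp_of (a *: p + q) n = a * amp_of p n + amp_of q n.
Proof. by rewrite /amp_of mcoeffD mcoeffZ mulrDr mulrCA. Qed.

Lemma amp_of_scale (a : C) p n : amp_of (a *: p) n = a * amp_of p n.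
Proof. by rewrite /amp_of mcoeffZ mulrCA. Qed.

Lemma mnm_decomp (n : 'X_{1..m}) j : n j != 0%N -> n = ((n - U_(j)) + U_(j))%MM.
Proof.
move=> nj; rewrite submK //; apply/mnm_lepP => i; rewrite mnm1E.
by case: eqP => [<-|//]; rewrite lt0n.
Qed.

Lemma mnm_factE (n : 'X_{1..m}) j : n j != 0%N ->
  mnm_fact n = (n j * mnm_fact (n - U_(j))%MM)%N.
Proof.
move=> nj; rewrite {1}(mnm_decomp nj) mnm_factU mnmBE mnm1E eqxx subn1.
by rewrite prednK ?lt0n.
Qed.

Lemma mcoeff_varM p j n :
  ('X_j * p)@_n = if n j == 0%N then 0 else p@_(n - U_(j)).
Proof.
case: eqP => [nj|/eqP nj]; last first.
  by rewrite {1}(mnm_decomp nj) mulrC addmC mcoeffMX.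
rewrite [p]mpolyE mulr_sumr linear_sum big1 //= => n' _.
rewrite -scalerAr mcoeffZ -mpolyXD mcoeffX; case: eqP => [E|_]; last by rewrite mulr0.
by move/eqP: nj; rewrite -E mnmDE mnm1E eqxx.
Qed.

Lemma creation_amp_of j p : creation j (amp_of p) = amp_of ('X_j * p).
Proof.
apply/funext => n; rewrite /creation /amp_of mcoeff_varM.
case: eqP => [->|/eqP nj]; first by rewrite sqrtC0 mul0r mulr0.
by rewrite mulrA -rootCMl ?ler0n // -natrM -mnm_factE.
Qed.

Lemma annihilation_amp_of j p : annihilation j (amp_of p) = amp_of p^`M(j).
Proof.
apply/funext => n; rewrite /annihilation /amp_of mnm_factU mcoeff_deriv.
rewrite natrM rootCMl ?ler0n // -[p@__ *+ _]mulr_natl -{3}[(n j).+1%:R]sqrtCK expr2.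
by rewrite -!mulrA [RHS]mulrCA [X in _ = _ * X]mulrCA.
Qed.

Lemma truncation_creation j phi k :
  truncation k.+1 (creation j phi) = 'X_j * truncation k phi.
Proof.
apply/mpolyP => n; rewrite mcoeff_truncation mcoeff_varM mcoeff_truncation.
rewrite /creation; case: eqP => [->|/eqP nj].
  by rewrite sqrtC0 mul0r; case: ifP; rewrite ?mul0r.
have dn : mdeg n = (mdeg (n - U_(j))%MM).+1 by rewrite {1}(mnm_decomp nj) mdegD mdeg1 addn1.
rewrite dn ltnS; case: ifP => // _.
rewrite (mnm_factE nj) natrM rootCMl ?ler0n // invfM mulrACA.
by rewrite divff ?mul1r // sqrtC_eq0 pnatr_eq0.
Qed.

Lemma vacuumE : vacuum R m = amp_of 1.
Proof.
apply/funext => n; rewrite /vacuum /amp_of mcoeff1.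
case: eqP => [->|_]; last by rewrite mulr0.
by rewrite /mnm_fact big1 ?sqrtC1 ?mulr1 // => i _; rewrite mnm0E fact0.
Qed.

Lemma second_quantization_creation V j phi n :
  second_quantization V (creation j phi) n =
  \sum_(k < m) V k j * creation k (second_quantization V phi) n.
Proof.
rewrite (second_quantizationE _ _ (leqnSn (mdeg n))) truncation_creation rmorphM /=.
rewrite linear_subst_var mulr_suml /amp_of linear_sum mulr_sumr; apply: eq_bigr => k _ /=.
rewrite -scalerAl mcoeffZ mulrCA; congr (_ * _).
rewrite [RHS](truncationE _ (leqnSn (mdeg n))) truncation_creation.
by rewrite truncation_second_quantization.
Qed.

Definition sqabs (z : C) : R := complex.Re z ^+ 2 + complex.Im z ^+ 2.

Lemma sqabs_ge0 z : 0 <= sqabs z.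
Proof. by rewrite addr_ge0 // sqr_ge0. Qed.

Lemma sqabsE z : (sqabs z)%:C%C = z * z^*.
Proof. by rewrite add_Re2_Im2 normCK. Qed.

(** The weight n! of the Bombieri product cancels the two factors 1/sqrt(n!) of the stellar
    coefficients. *)
Lemma sum_sqabs_truncation k phi :
  (\sum_(n : 'X_{1..m < k.+1}) sqabs (phi n))%:C%C =
  monomial_functional (bombieri (truncation k phi)) (truncation k phi).
Proof.
rewrite (@monomial_functionalwE _ _ _ _ k.+1); last first.
  rewrite msizeE; apply/bigmax_leqP_seq => n + _.
  rewrite mcoeff_msupp mcoeff_truncation ltnS.
  by case: ifP => //; rewrite eqxx.
rewrite rmorph_sum; apply: eq_bigr => n _ /=.
rewrite /bombieri mcoeff_truncation -ltnS bmdeg sqabsE.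
have s0 := sqrtC_fact_neq0 n.
have sJ : (sqrtC (mnm_fact n)%:R)^* = sqrtC (mnm_fact n)%:R :> C.
  by apply: geC0_conj; rewrite sqrtC_ge0 ler0n.
have -> : (phi n / sqrtC (mnm_fact n)%:R)^* = (phi n)^* / sqrtC (mnm_fact n)%:R.
  by rewrite rmorphM /= fmorphV /= sJ.
rewrite -{2}(sqrtCK (mnm_fact n)%:R) expr2.
by rewrite -!mulrA mulKf // [X in _ = _ * X]mulrC divfK.
Qed.

Lemma sqnorm_second_quantization_le V phi : V \is unitarymx ->
  (sqnorm (second_quantization V phi) <= sqnorm phi)%E.
Proof.
move=> Vu; apply: (esum_mnm_le (f := fun n => sqabs _)) => [n|k]; first exact: sqabs_ge0.
apply: le_trans (esum_mnm_ge k.+1 (fun n => sqabs_ge0 (phi n))).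
rewrite lee_fin -lecR !sum_sqabs_truncation truncation_second_quantization.
by rewrite bombieri_unitary.
Qed.

(** The converse inequality is the previous one for the inverse matrix, applied to the image of
    phi. *)
Lemma sqnorm_second_quantization V phi : V \is unitarymx ->
  sqnorm (second_quantization V phi) = sqnorm phi.
Proof.
move=> Vu; apply/eqP; rewrite eq_le sqnorm_second_quantization_le //=.
rewrite -{1}[phi]second_quantization1.
have /unitarymxP/mulmx1C <- := Vu; rewrite -second_quantizationM.
by apply: sqnorm_second_quantization_le; rewrite trmxC_unitary.
Qed.

Lemma second_quantization_interferometer V : V \is unitarymx ->
  interferometer (second_quantization V).
Proof.
move=> Vu; split; last 2 first.
- by rewrite vacuumE second_quantization_amp_of rmorph1.
- exists V => // j phi _ _; apply/funext => n; exact: second_quantization_creation.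
split => [phi|a phi chi _ _|phi _|chi chiF].
- by rewrite /in_fock sqnorm_second_quantization.
- apply/funext => n; rewrite /second_quantization truncation_is_linear linearP /=.
  exact: amp_of_linear.
- exact: sqnorm_second_quantization.
- exists (second_quantization (V^t*)%sesqui chi).
    by rewrite /in_fock sqnorm_second_quantization // trmxC_unitary.
  by rewrite second_quantizationM (unitarymxP _) ?second_quantization1.
Qed.

End FockSpace.
(** * Convergence of the displacement series *)

Section GeometricLimits.
Variable R : realType.
Local Notation C := R[i].
Implicit Types (u v : nat -> C) (l : C).

(** The explicit rate turns statements on limits into inequalities valid for every K. *)
Definition geometric_limit u l :=
  exists B : R, forall K, `|u K - l| <= (B * 2^-1 ^+ K)%:C%C.

Lemma half_pow_gt0 K : 0 < 2^-1 ^+ K :> R.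
Proof. by rewrite exprn_gt0 // invr_gt0 ltr0n. Qed.

Lemma half_pow_small (x B : R) : (forall K, x <= B * 2^-1 ^+ K) -> x <= 0.
Proof.
move=> xB; rewrite leNgt; apply/negP => x0.
have B0 : 0 < B by have := lt_le_trans x0 (xB 0%N); rewrite expr0 mulr1.
have := archi_boundP (ltW (divr_gt0 B0 x0)); set K := Num.bound _ => BK.
have := xB K; rewrite leNgt => /negP; apply.
rewrite exprVn ltr_pdivrMr ?exprn_gt0 ?ltr0n // mulrC -ltr_pdivrMr //.
by apply: (lt_trans BK); rewrite -natrX ltr_nat ltn_expl.
Qed.

Lemma geometric_limit_unique u l l' :
  geometric_limit u l -> geometric_limit u l' -> l = l'.
Proof.
move=> [B uB] [B' uB']; apply/eqP; rewrite -subr_eq0 -normr_eq0.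
have nE : `|l - l'| = (complex.Re `|l - l'|)%:C%C by rewrite RRe_real ?normr_real.
rewrite eq_le normr_ge0 andbT nE -[0]/(0%:C%C) lecR.
apply: (@half_pow_small _ (B + B')) => K; rewrite -lecR -nE mulrDl.
rewrite (_ : l - l' = (u K - l') - (u K - l)); last by ring.
by rewrite (le_trans (ler_normB _ _)) // addrC raddfD lerD.
Qed.

Lemma eq_geometric_limit u v l : u =1 v -> geometric_limit u l -> geometric_limit v l.
Proof. by move=> uv [B uB]; exists B => K; rewrite -uv. Qed.

Lemma geometric_limit0 : geometric_limit (fun=> 0) 0.
Proof. by exists 0 => K; rewrite subrr normr0 mul0r. Qed.

Lemma geometric_limit_linear (a : C) u v l l' : geometric_limit u l ->
  geometric_limit v l' -> geometric_limit (fun K => a * u K + v K) (a * l + l').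
Proof.
move=> [B uB] [B' uB']; exists (complex.Re `|a| * B + B') => K.
have nE : `|a| = (complex.Re `|a|)%:C%C by rewrite RRe_real ?normr_real.
rewrite opprD addrACA -mulrBr (le_trans (ler_normD _ _)) // mulrDl -mulrA.
by rewrite [leRHS]raddfD /= [X in _ <= X + _]rmorphM /= -nE lerD // normrM ler_wpM2l.
Qed.

Lemma geometric_limit_sum (I : Type) (r : seq I) (a : I -> C) (u : I -> nat -> C) (l : I -> C) :
  (forall i, geometric_limit (u i) (l i)) ->
  geometric_limit (fun K => \sum_(i <- r) a i * u i K) (\sum_(i <- r) a i * l i).
Proof.
move=> ul; elim: r => [|i r IH].
  rewrite big_nil; apply: eq_geometric_limit geometric_limit0 => K.
  by rewrite big_nil.
rewrite big_cons; apply: eq_geometric_limit (geometric_limit_linear (a i) (ul i) IH) => K.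
by rewrite big_cons.
Qed.

Lemma geometric_limit_shift u l :
  geometric_limit (fun K => u K.+1) l -> geometric_limit u l.
Proof.
move=> [B uB].
have nE : `|u 0%N - l| = (complex.Re `|u 0%N - l|)%:C%C by rewrite RRe_real ?normr_real.
have B0 : 0 <= B.
  by rewrite -lecR; apply: le_trans (normr_ge0 _) (le_trans (uB 0%N) _); rewrite expr0 mulr1.
(* The first summand covers index 0; the factor 2 pays for the halving lost in the shift. *)
exists (complex.Re `|u 0%N - l| + 2 * B) => -[|K].
  by rewrite expr0 mulr1 nE lecR lerDl mulr_ge0 ?ler0n.
have c0 : 0 <= complex.Re `|u 0%N - l| by rewrite -lecR -nE; apply: normr_ge0.
apply: le_trans (uB K) _; rewrite lecR exprS mulrA.
apply: ler_wpM2r; first exact/ltW/half_pow_gt0.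
move: (complex.Re _) c0 {nE uB} => c c0.
lra.
Qed.

(** The intervals of radius [2 * B * 2^-1 ^+ K] around the partial sums are nested; the limit is the
    supremum of their lower ends. *)
Lemma half_series_tail (u : nat -> R) (B : R) :
  (forall k, `|u k| <= B * 2^-1 ^+ k) ->
  exists s, forall K, `|\sum_(k < K) u k - s| <= 2 * B * 2^-1 ^+ K.
Proof.
move=> uB; pose e K : R := 2 * B * 2^-1 ^+ K.
pose w K := \sum_(k < K) u k - e K; pose v K := \sum_(k < K) u k + e K.
have eS K : e K = e K.+1 + B * 2^-1 ^+ K.
  by rewrite /e exprS; field.
have uK K : - (B * 2^-1 ^+ K) <= u K /\ u K <= B * 2^-1 ^+ K.
  by apply/andP; rewrite -ler_norml.
have wS K : w K <= w K.+1.
  by rewrite /w big_ord_recr /= (eS K); have [] := uK K; lra.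
have vS K : v K.+1 <= v K.
  by rewrite /v big_ord_recr /= (eS K); have [] := uK K; lra.
have wM : {homo w : i j / (i <= j)%N >-> i <= j} by exact: homo_leq lexx le_trans wS.
have vM : {homo v : i j / (i <= j)%N >-> j <= i}.
  by apply: (homo_leq (r := fun x y => y <= x)) => // y x z xy /le_trans; apply.
have e0 K : 0 <= e K.
  apply: mulr_ge0; last exact/ltW/half_pow_gt0.
  apply: mulr_ge0; first by rewrite ler0n.
  by have := le_trans (normr_ge0 _) (uB 0%N); rewrite expr0 mulr1.
have wv K L : w K <= v L.
  apply: (le_trans (wM _ _ (leq_maxl K L))).
  apply: le_trans (vM _ _ (leq_maxr K L)).
  by rewrite lerD2l; have := e0 (maxn K L); lra.
pose W := [set w K | K in [set: nat]]%classic.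
have Wub L : ubound W (v L) by move=> _ [K _ <-].
have W0 : (W !=set0)%classic by exists (w 0%N), 0%N.
exists (sup W) => K; rewrite ler_distl; apply/andP; split.
  rewrite -/(e K) lerBlDr.
  by apply: ge_sup => //; apply: Wub.
rewrite -/(e K) -lerBlDr.
by apply: ub_le_sup; [exists (v 0%N)|exists K].
Qed.

Lemma half_series_tail_complex u (B : R) :
  (forall k, `|u k| <= (B * 2^-1 ^+ k)%:C%C) ->
  exists l, forall K, `|\sum_(k < K) u k - l| <= (4 * B * 2^-1 ^+ K)%:C%C.
Proof.
move=> uB.
have normIm (z : C) : `|complex.Im z|%:C%C <= `|z|.
  by rewrite -[complex.Im z]opprK -ReiNIm normrN (le_trans (normc_ge_Re _)) //
    normrM complexiE normCi mulr1.
have [k|a aP] := @half_series_tail (fun k => complex.Re (u k)) B.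
  by rewrite -lecR (le_trans (normc_ge_Re _)).
have [k|b bP] := @half_series_tail (fun k => complex.Im (u k)) B.
  by rewrite -lecR (le_trans (normIm _)).
exists (Complex a b) => K; set z := _ - _.
rewrite [z]complexE (le_trans (ler_normD _ _)) // normrM complexiE normCi mul1r.
have normR (x : R) : `|x%:C%C| = `|x|%:C%C :> C.
  by rewrite normc_def /= expr0n addr0 sqrtr_sqr.
rewrite !normR -raddfD lecR.
have -> : complex.Re z = \sum_(k < K) complex.Re (u k) - a.
  have D : {morph @complex.Re R : x y / x + y} by move=> [? ?] [? ?].
  by rewrite /z D (big_morph _ D (erefl _)).
have -> : complex.Im z = \sum_(k < K) complex.Im (u k) - b.
  have D : {morph @complex.Im R : x y / x + y} by move=> [? ?] [? ?].
  by rewrite /z D (big_morph _ D (erefl _)).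
apply: le_trans (lerD (aP K) (bP K)) _.
by rewrite -mulrDl -mulrDl -natrD.
Qed.

End GeometricLimits.

(** * Factorials against products of square roots *)

Section RapidDecay.
Variable R : realType.

Lemma eventually_halving (u : nat -> R) N : (forall k, 0 <= u k) ->
  (forall k, (N <= k)%N -> u k.+1 <= 2^-1 * u k) ->
  exists2 B, 0 <= B & forall k, u k <= B * 2^-1 ^+ k.
Proof.
move=> u0 uN; pose B := \sum_(k < N.+1) u k * 2 ^+ k.
have B0 : 0 <= B by apply: sumr_ge0 => k _; rewrite mulr_ge0 ?exprn_ge0.
exists B => // k; elim: k => [|k IH].
  rewrite expr0 mulr1 /B big_ord_recl /= expr0 mulr1 lerDl.
  by apply: sumr_ge0 => k _; rewrite mulr_ge0 ?exprn_ge0.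
have [kN|Nk] := ltnP k N; last first.
  by apply: le_trans (uN _ Nk) _; rewrite exprS mulrCA ler_pM2l ?invr_gt0 ?ltr0n.
rewrite exprVn ler_pdivlMr ?exprn_gt0 ?ltr0n //.
have kN1 : (k.+1 < N.+1)%N by [].
rewrite /B (bigD1 (Ordinal kN1)) //= lerDl.
by apply: sumr_ge0 => i _; rewrite mulr_ge0 ?exprn_ge0.
Qed.

Lemma sqrt_product_decay d : exists2 B : R, 0 <= B &
  forall k, \prod_(i < k) (3 * Num.sqrt (d + i).+1%:R / i.+1%:R) <= B * 2^-1 ^+ k.
Proof.
(* The ratio of successive products is at most 1/2 once 36 (d + k + 1) <= (k + 1)^2, which holds
   from this index on because d + k + 1 <= (d + 1)(k + 1). *)
apply: (@eventually_halving _ (36 * d.+1)%N) => [k|k dk].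
  by apply: prodr_ge0 => i _; rewrite divr_ge0 ?mulr_ge0 ?sqrtr_ge0.
rewrite big_ord_recr /= mulrC ler_wpM2r //.
  by apply: prodr_ge0 => i _; rewrite divr_ge0 ?mulr_ge0 ?sqrtr_ge0.
rewrite ler_pdivrMr ?ltr0n //.
suff : Num.sqrt (d + k).+1%:R <= k.+1%:R / 6 :> R by lra.
rewrite -[leRHS]ger0_norm ?divr_ge0 // -sqrtr_sqr ler_wsqrtr //.
rewrite expr_div_n ler_pdivlMr ?exprn_gt0 ?ltr0n //.
rewrite -!natrX -natrM ler_nat.
nia.
Qed.

End RapidDecay.

Section Displacement.
Variables (R : realType) (m : nat) (j : 'I_m).
Local Notation C := R[i].
Implicit Types (phi chi : amp R m) (n : 'X_{1..m}).

Lemma sqrtC_nat k : sqrtC k%:R = (Num.sqrt k%:R)%:C%C :> C.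
Proof.
have E : k%:R = (Num.sqrt k%:R : R)%:C%C ^+ 2 :> C.
  by rewrite -rmorphXn /= sqr_sqrtr ?ler0n // rmorph_nat.
by rewrite {1}E sqrCK // -[0]/(0%:C%C) lecR sqrtr_ge0.
Qed.

Lemma generatorE phi n :
  displacement_generator j (-1) phi n = annihilation j phi n - creation j phi n.
Proof. by rewrite /displacement_generator rmorphN1 !mulN1r opprK addrC. Qed.

(** The degree bound D controls the square roots of occupation numbers; the weight 2^-|n| ensures
    square-summability and changes only by a factor 2 when one photon is added or removed. *)
Definition weighted_bound D (b : R) phi :=
  (forall n, (D < mdeg n)%N -> phi n = 0) /\
  (forall n, `|phi n| <= (b * 2^-1 ^+ mdeg n)%:C%C).

Lemma norm_sqrtC_mul_le D k (z : C) (b : R) : (k <= D)%N -> `|z| <= b%:C%C ->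
  `|sqrtC k%:R * z| <= (Num.sqrt D%:R * b)%:C%C.
Proof.
move=> kD zb; rewrite normrM rmorphM /=; apply: ler_pM => //.
by rewrite sqrtC_nat normc_def /= expr0n addr0 sqrtr_sqr lecR ger0_norm ?sqrtr_ge0 //
  ler_wsqrtr // ler_nat.
Qed.

Lemma mnm_le_mdeg n i : (n i <= mdeg n)%N.
Proof. by rewrite mdegE (bigD1 i) //= leq_addr. Qed.

(** Creation reads the amplitude one degree lower and doubles the weight, annihilation halves it; 2
    + 1/2 is rounded up to 3. *)
Lemma weighted_bound_generator D b phi : weighted_bound D b phi ->
  weighted_bound D.+1 (3 * Num.sqrt D.+1%:R * b) (displacement_generator j (-1) phi).
Proof.
move=> [supp bnd].
have b0 : 0 <= b.
  have /(le_trans (normr_ge0 _)) := bnd 0%MM.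
  by rewrite mdeg0 expr0 mulr1 -[0]/(0%:C%C) lecR.
have dU n : n j != 0%N -> mdeg n = (mdeg (n - U_(j))%MM).+1.
  by move=> nj; rewrite {1}(mnm_decomp nj) mdegD mdeg1 addn1.
have dD n : mdeg (n + U_(j))%MM = (mdeg n).+1 by rewrite mdegD mdeg1 addn1.
split=> n.
  move=> Dn; rewrite generatorE /creation /annihilation supp ?mulr0 ?sub0r; last first.
    by rewrite dD; apply: leqW; apply: ltnW.
  have [nj|nj] := eqVneq (n j) 0%N; first by rewrite nj sqrtC0 mul0r oppr0.
  by rewrite supp ?mulr0 ?oppr0 //; rewrite (dU _ nj) in Dn.
have s0 : 0 <= Num.sqrt D.+1%:R :> R by apply: sqrtr_ge0.
have q0 := half_pow_gt0 R (mdeg n).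
have ub0 (x : R) : 0 <= x -> 0 <= (Num.sqrt D.+1%:R * (b * (x * 2^-1 ^+ mdeg n)))%:C%C :> C.
  move=> x0; rewrite -[0]/(0%:C%C) lecR.
  by apply: mulr_ge0 => //; apply: mulr_ge0 => //; apply: mulr_ge0 => //; apply: ltW.
have cb : `|creation j phi n| <= (Num.sqrt D.+1%:R * (b * (2 * 2^-1 ^+ mdeg n)))%:C%C.
  rewrite /creation; have [nj|nj] := eqVneq (n j) 0%N.
    by rewrite nj sqrtC0 mul0r normr0; apply: ub0.
  have [nD|Dn] := leqP (mdeg n) D.+1; last first.
    by rewrite supp ?mulr0 ?normr0; [apply: ub0|rewrite (dU _ nj) in Dn].
  apply: norm_sqrtC_mul_le; first by apply: leq_trans nD; apply: mnm_le_mdeg.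
  apply: le_trans (bnd _) _; rewrite lecR (dU _ nj) exprS mulrA mulfV ?pnatr_eq0 //.
  by rewrite mul1r.
have ab : `|annihilation j phi n| <= (Num.sqrt D.+1%:R * (b * (2^-1 * 2^-1 ^+ mdeg n)))%:C%C.
  rewrite /annihilation; have [nD|Dn] := leqP (mdeg n) D; last first.
    by rewrite supp ?mulr0 ?normr0; [apply: ub0; rewrite invr_ge0|rewrite dD ltnW].
  apply: norm_sqrtC_mul_le; first by rewrite ltnS; apply: leq_trans nD; apply: mnm_le_mdeg.
  by rewrite -exprS -dD.
rewrite generatorE (le_trans (ler_normB _ _)) //; apply: le_trans (lerD ab cb) _.
rewrite -raddfD lecR /= -mulrDr -mulrDr -mulrDl.
rewrite -[leRHS]mulrA [3 * _]mulrC -[leRHS]mulrA ler_wpM2l // mulrCA.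
by apply: ler_wpM2r; [apply: mulr_ge0 => //; apply: ltW|lra].
Qed.

Lemma weighted_bound_iter d b phi k : weighted_bound d b phi ->
  weighted_bound (d + k) ((\prod_(i < k) (3 * Num.sqrt (d + i).+1%:R)) * b)
    (iter k (displacement_generator j (-1)) phi).
Proof.
move=> wb; elim: k => [|k IH] /=; first by rewrite big_ord0 mul1r addn0.
rewrite addnS big_ord_recr /= [_ * (3 * _)]mulrC -mulrA.
exact: weighted_bound_generator.
Qed.

Lemma exp_terms_bound d b phi : weighted_bound d b phi ->
  exists B : R, forall k n,
  `|(k`!)%:R^-1 * iter k (displacement_generator j (-1)) phi n| <=
  (B * 2^-1 ^+ mdeg n * 2^-1 ^+ k)%:C%C.
Proof.
move=> wb; have [B B0 BP] := sqrt_product_decay R d.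
have b0 : 0 <= b.
  have /(le_trans (normr_ge0 _)) := wb.2 0%MM.
  by rewrite mdeg0 expr0 mulr1 -[0]/(0%:C%C) lecR.
exists (B * b) => k n; have [_ /(_ n) it] := weighted_bound_iter k wb.
have -> : k`!%:R^-1 = (k`!%:R^-1 : R)%:C%C :> C by rewrite fmorphV rmorph_nat.
have f0 : 0 < k`!%:R :> R by rewrite ltr0n fact_gt0.
have -> : forall z : C, `|(k`!%:R^-1 : R)%:C%C * z| = (k`!%:R^-1 : R)%:C%C * `|z|.
  by move=> z; rewrite normrM ger0_norm // -[0]/(0%:C%C) lecR invr_ge0 ltW.
apply: (le_trans (ler_wpM2l _ it)); first by rewrite -[0]/(0%:C%C) lecR invr_ge0 ltW.
rewrite -rmorphM lecR /= ler_pdivrMl //.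
have pE : \prod_(i < k) (3 * Num.sqrt (d + i).+1%:R) =
    k`!%:R * \prod_(i < k) (3 * Num.sqrt (d + i).+1%:R / i.+1%:R) :> R.
  elim: (k) => [|l IH]; first by rewrite !big_ord0 mulr1.
  rewrite !big_ord_recr /= IH factS natrM; field.
  by rewrite nat1r pnatr_eq0.
rewrite pE -!mulrA ler_pM2l //.
have q0 : 0 <= b * 2^-1 ^+ mdeg n by rewrite mulr_ge0 // ltW ?half_pow_gt0.
apply: (le_trans (ler_wpM2r q0 (BP k))).
by rewrite -!mulrA ler_wpM2l // mulrC -!mulrA.
Qed.

(** Multi-indices of degree below k inject into a box of side k, where the sum factors into m
    geometric sums, each at most 2. *)
Lemma sum_half_pow_mdeg k : \sum_(n : 'X_{1..m < k}) 2^-1 ^+ mdeg n <= 2 ^+ m :> R.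
Proof.
pose h (n : 'X_{1..m < k}) : {ffun 'I_m -> 'I_k} :=
  [ffun i => Ordinal (leq_ltn_trans (mnm_le_mdeg n i) (bmdeg n))].
have h_inj : injective h.
  move=> n n' /ffunP hn; apply/val_inj/mnmP => i /=.
  by have := congr1 val (hn i); rewrite !ffunE.
have geo : \sum_(i < k) 2^-1 ^+ i <= 2 :> R.
  have -> : \sum_(i < k) 2^-1 ^+ i = 2 - 2 * 2^-1 ^+ k :> R.
    elim: k {h h_inj} => [|k IH]; first by rewrite big_ord0 expr0 mulr1 subrr.
    by rewrite big_ord_recr /= IH exprS; field.
  by have := half_pow_gt0 R k; lra.
pose G (f : {ffun 'I_m -> 'I_k}) : R := \prod_i 2^-1 ^+ f i.
have hG (n : 'X_{1..m < k}) : 2^-1 ^+ mdeg n = G (h n).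
  rewrite mdegE -prodrXr /G; apply: eq_bigr => i _; by rewrite ffunE.
under eq_bigr do rewrite hG.
apply: (@le_trans _ _ (\sum_f G f)).
  rewrite -(big_imset _ (h := h) (A := predT)) /=; last by move=> ? ? _ _; apply: h_inj.
  rewrite [leRHS](bigID (fun f => f \in [set h x | x in predT])) /= lerDl.
  by apply: sumr_ge0 => f _; apply: prodr_ge0 => i _; apply/ltW/half_pow_gt0.
rewrite -(bigA_distr_bigA (fun (_ : 'I_m) (i : 'I_k) => 2^-1 ^+ i : R)) /=.
rewrite prodr_const card_ord lerXn2r ?nnegrE ?ler0n //.
by apply: sumr_ge0 => i _; apply/ltW/half_pow_gt0.
Qed.

Lemma sqnorm_le (b : R) phi : 0 <= b ->
  (forall n, `|phi n| <= (b * 2^-1 ^+ mdeg n)%:C%C) ->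
  (sqnorm phi <= (b ^+ 2 * 2 ^+ m)%:E)%E.
Proof.
move=> b0 bnd; apply: (esum_mnm_le (f := fun n => sqabs (phi n))) => [n|k].
  exact: sqabs_ge0.
rewrite lee_fin.
apply: le_trans (ler_wpM2l (sqr_ge0 b) (sum_half_pow_mdeg k.+1)).
rewrite mulr_sumr; apply: ler_sum => n _.
have q0 := ltW (half_pow_gt0 R (mdeg n)).
apply: (@le_trans _ _ ((b * 2^-1 ^+ mdeg n) ^+ 2)).
  rewrite -lecR sqabsE -normCK rmorphXn lerXn2r // nnegrE //=.
  by rewrite -[0]/(0%:C%C) lecR mulr_ge0.
rewrite exprMn ler_wpM2l ?sqr_ge0 // expr2 -[leRHS]mul1r ler_wpM2r //.
by rewrite exprVn invf_le1 ?exprn_gt0 ?ltr0n // exprn_ege1 // ler1n.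
Qed.

(** The terms decay both in the multi-index and in k: the former bounds the squared norm of a
    remainder, the latter sends it to 0. The pointwise limit is recorded too, since projections read
    single amplitudes. *)
Lemma displacement_exists d b phi : weighted_bound d b phi ->
  exists2 chi, is_displaced j (-1) phi chi & forall n, geometric_limit
    (fun K => \sum_(k < K) (k`!)%:R^-1 * iter k (displacement_generator j (-1)) phi n)
    (chi n).
Proof.
move=> /exp_terms_bound[B BP].
have /choice[chi chiP] n := half_series_tail_complex (fun k => BP k n).
exists chi; last by move=> n; exists (4 * (B * 2^-1 ^+ mdeg n)).
have B0 : 0 <= B.
  have /(le_trans (normr_ge0 _)) := BP 0%N 0%MM.
  by rewrite mdeg0 !expr0 !mulr1 -[0]/(0%:C%C) lecR.
pose c : R := (4 * B) ^+ 2 * 2 ^+ m.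
rewrite /is_displaced /is_exp.
apply: (@squeeze_cvge _ _ _ _ (fun=> 0%E) _ (fun K => (c * 2^-1 ^+ K)%:E)).
- apply: nearW => K; apply/andP; split; first by apply: esum_ge0 => n _; rewrite lee_fin sqabs_ge0.
  apply: (le_trans (@sqnorm_le (4 * B * 2^-1 ^+ K) _ _ _)).
  + by rewrite !mulr_ge0 ?ler0n //; apply/ltW/half_pow_gt0.
  + by move=> n; apply: le_trans (chiP n K) _; rewrite lecR mulrA mulrAC.
  rewrite lee_fin exprMn /c mulrAC ler_wpM2l //.
    by rewrite mulr_ge0 ?sqr_ge0 ?exprn_ge0.
  rewrite expr2 -[leRHS]mul1r ler_wpM2r //.
  by rewrite exprVn invf_le1 ?exprn_gt0 ?ltr0n // exprn_ege1 // ler1n.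
- exact: cvg_cst.
- apply: cvg_EFin; first exact: nearW.
  apply: (@cvg_geometric R c 2^-1); rewrite ger0_norm ?invr_ge0 //; lra.
Qed.

Lemma finite_weighted_bound d phi : (forall n, (d < mdeg n)%N -> phi n = 0) ->
  exists b, weighted_bound d b phi.
Proof.
move=> supp.
pose B : C := \sum_(n : 'X_{1..m < d.+1}) `|phi n| * 2 ^+ mdeg n.
have B0 : 0 <= B by apply: sumr_ge0 => n _; rewrite mulr_ge0 ?exprn_ge0.
exists (complex.Re B); split => // n.
rewrite rmorphM rmorphXn fmorphV rmorph_nat /= RRe_real ?ger0_real //.
have [nd|dn] := leqP (mdeg n) d; last first.
  by rewrite supp // normr0 mulr_ge0 // exprn_ge0 ?invr_ge0.
rewrite exprVn ler_pdivlMr ?exprn_gt0 ?ltr0n //.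
rewrite /B (bigD1 (BMultinom (nd : (mdeg n < d.+1)%N))) //= lerDl.
by apply: sumr_ge0 => n' _; rewrite mulr_ge0 ?exprn_ge0.
Qed.

End Displacement.
(** * Vacuum projection of displaced states *)

Section InsertMode.
Variables (m : nat) (j : 'I_m.+1).
Implicit Types n a : 'X_{1..m}.

Lemma insert_mode_at p n : insert_mode j p n j = p.
Proof. by rewrite mnmE unlift_none. Qed.

Lemma insert_mode_lift p n i : insert_mode j p n (lift j i) = n i.
Proof. by rewrite mnmE liftK. Qed.

Lemma insert_modeK p n : remove_mode j (insert_mode j p n) = n.
Proof. by apply/mnmP => i; rewrite mnmE insert_mode_lift. Qed.

Lemma remove_modeK (n : 'X_{1..m.+1}) : insert_mode j (n j) (remove_mode j n) = n.
Proof.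
apply/mnmP => i; case: (unliftP j i) => [i' ->|->]; last by rewrite insert_mode_at.
by rewrite insert_mode_lift mnmE.
Qed.

Lemma insert_mode_eq p n p' n' :
  (insert_mode j p n == insert_mode j p' n') = (p == p') && (n == n').
Proof.
apply/eqP/andP => [E|[/eqP-> /eqP->] //]; split; apply/eqP.
  by rewrite -(insert_mode_at p n) E insert_mode_at.
by rewrite -(insert_modeK p n) E insert_modeK.
Qed.

Lemma insert_modeS p n : insert_mode j p.+1 n = (U_(j) + insert_mode j p n)%MM.
Proof.
apply/mnmP => i; rewrite mnmDE mnm1E.
case: (unliftP j i) => [i' ->|->]; last by rewrite !insert_mode_at eqxx add1n.
by rewrite !insert_mode_lift (negbTE (neq_lift j i')).
Qed.

Lemma mnm_fact_insert_mode p n :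
  mnm_fact (insert_mode j p n) = (p`! * mnm_fact n)%N.
Proof.
rewrite /mnm_fact (bigD1_ord j) //= insert_mode_at; congr (_ * _)%N.
by apply: eq_bigr => i _; rewrite insert_mode_lift.
Qed.

End InsertMode.

Section VacuumAmplitude.
Variable R : realType.

(* [vacuum_term k] is <0|A^k|0> / k! for A = a - a^dagger; the sum is exp(-1/2). *)
Fixpoint vacuum_term (k : nat) : R :=
  match k with
  | 0%N => 1
  | 1%N => 0
  | k'.+2 => - vacuum_term k' / k'.+2%:R
  end.

Lemma vacuum_term_bound k : `|vacuum_term k| <= 2 * 2^-1 ^+ k.
Proof.
(* The recursion skips one index, so two consecutive bounds are carried; a division by at least 4
   pays for two halvings. *)
suff : `|vacuum_term k| <= 2 * 2^-1 ^+ k /\ `|vacuum_term k.+1| <= 2 * 2^-1 ^+ k.+1.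
  by case.
elim: k => [|k [IH IH1]].
  by rewrite /= normr1 normr0 expr0 expr1; split; lra.
split=> //; case: k IH {IH1} => [_|[_|k IH]].
- by rewrite /= normrM normrN1 ger0_norm ?invr_ge0 // !exprS expr0; lra.
- by rewrite /= oppr0 mul0r normr0 mulr_ge0 // exprn_ge0 ?invr_ge0.
have -> : vacuum_term k.+4 = - vacuum_term k.+2 / k.+4%:R by [].
rewrite normrM normrN normfV ler_pdivrMr ?normr_gt0 ?pnatr_eq0 //.
apply: le_trans IH _; rewrite ger0_norm ?ler0n // [in leRHS]exprS [in leRHS]exprS.
have q0 := half_pow_gt0 R k.+2; set x := _ ^+ _ in q0 *.
have k4 : 4 <= k.+4%:R :> R by rewrite ler_nat.
have := ler_wpM2l (ltW q0) k4; lra.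
Qed.

Lemma vacuum_amplitude : exists2 e : R, e != 0 &
  geometric_limit (fun K => \sum_(k < K) (vacuum_term k)%:C%C) e%:C%C.
Proof.
have [e eP] := half_series_tail vacuum_term_bound.
exists e; last first.
  exists (2 * 2) => K; rewrite -rmorph_sum -raddfB normc_def /= expr0n addr0 sqrtr_sqr.
  by rewrite lecR; apply: eP.
(* The first five terms sum to 1 - 1/2 + 1/8 = 5/8 and the remainder is at most 4 / 2^5 = 1/8, so
   the limit is not 0. *)
have := eP 5%N; rewrite !big_ord_recr big_ord0 /= ler_norml => /andP[_].
by apply: contraTneq => ->; rewrite -ltNge !exprS expr0; lra.
Qed.

Section Displaced.
Variables (m : nat) (j : 'I_m.+1).
Local Notation C := R[i].
Implicit Types (p q : {mpoly C[m.+1]}) (n a : 'X_{1..m}).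

Definition generator_poly q : {mpoly C[m.+1]} := q^`M(j) - 'X_j * q.

Lemma generator_poly_is_linear : linear generator_poly.
Proof.
move=> a p q; rewrite /generator_poly linearP /= mulrDr -scalerAr scalerBr.
by rewrite opprD addrACA.
Qed.

Definition iter_generator k q := iter k generator_poly q.

Lemma iter_generator_is_linear k : linear (iter_generator k).
Proof.
move=> a p q; elim: k => [|k IH] //=.
by rewrite IH generator_poly_is_linear.
Qed.
HB.instance Definition _ k := GRing.isLinear.Build C {mpoly C[m.+1]} {mpoly C[m.+1]} _
  (iter_generator k) (iter_generator_is_linear k).

Lemma iter_generator_amp_of k q :
  iter k (displacement_generator j (-1)) (amp_of q) = amp_of (iter_generator k q).
Proof.
elim: k => [|k IH] //=; rewrite IH; apply/funext => n.
rewrite generatorE annihilation_amp_of creation_amp_of.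
by rewrite /generator_poly /amp_of mcoeffB mulrBr.
Qed.

(* The commutation relation [A, a^dagger] = 1 *)
Lemma iter_generator_varM k q : iter_generator k ('X_j * q) =
  'X_j * iter_generator k q + k%:R *: iter_generator k.-1 q.
Proof.
elim: k => [|k IH]; first by rewrite scale0r addr0.
rewrite {1}/iter_generator iterS -/(iter_generator k _) IH.
rewrite -[X in generator_poly X]addrC generator_poly_is_linear.
have -> : k%:R *: generator_poly (iter_generator k.-1 q) = k%:R *: iter_generator k q.
  by case: (k) => [|l] //; rewrite !scale0r.
rewrite {1}/generator_poly mderivM mderiv_var eqxx mul1r /= -natr1 scalerDl scale1r.
rewrite -/(iter_generator k q) /generator_poly.
ring.
Qed.

(** A term of the exponential series after vacuum projection of mode j; the normalization sqrt(n!),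
    common to all k, is left out. *)
Definition vacuum_coeff k q n : C :=
  (k`!)%:R^-1 * (iter_generator k q)@_(insert_mode j 0 n).

(** Once commuted to the left, ['X_j] is killed by the vacuum projection; the commutator contributes
    k + 1, which reduces (k + 1)! to k!. *)
Lemma vacuum_coeff_varM k q n :
  vacuum_coeff k.+1 ('X_j * q) n = vacuum_coeff k q n.
Proof.
rewrite /vacuum_coeff iter_generator_varM mcoeffD mcoeff_varM insert_mode_at eqxx.
rewrite add0r mcoeffZ mulrA; congr (_ * _).
by rewrite factS natrM invfM mulrC mulrA divff ?mul1r // pnatr_eq0.
Qed.

(** On a monomial free of ['X_j] the generator acts as multiplication by [- 'X_j], which the
    previous lemma absorbs: two orders are gained for one division by k + 2. *)
Lemma vacuum_coeff_vacuum k a n :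
  vacuum_coeff k 'X_[insert_mode j 0 a] n = (vacuum_term k)%:C%C * (a == n)%:R.
Proof.
have gX : generator_poly 'X_[insert_mode j 0 a] = - ('X_j * 'X_[insert_mode j 0 a]).
  by rewrite /generator_poly mderivX insert_mode_at scale0r sub0r.
have step l : vacuum_coeff l.+2 'X_[insert_mode j 0 a] n =
    - vacuum_coeff l 'X_[insert_mode j 0 a] n / l.+2%:R.
  rewrite -(vacuum_coeff_varM l) /vacuum_coeff /iter_generator iterSr gX.
  rewrite -!/(iter_generator _ _) linearN mcoeffN [in LHS]factS natrM invfM.
  by rewrite mulrN [RHS]mulNr -mulrA; congr (- _); apply: mulrC.
suff : vacuum_coeff k 'X_[insert_mode j 0 a] n = (vacuum_term k)%:C%C * (a == n)%:R /\
    vacuum_coeff k.+1 'X_[insert_mode j 0 a] n = (vacuum_term k.+1)%:C%C * (a == n)%:R.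
  by case.
elim: k => [|k [IH IH1]]; last first.
  split=> //; rewrite step IH /= rmorphM fmorphV rmorphN rmorph_nat /=.
  by rewrite mulrAC !mulNr mulrAC.
split.
  by rewrite /vacuum_coeff /= mcoeffX insert_mode_eq eqxx invr1 rmorph1.
rewrite /vacuum_coeff /iter_generator /= gX mcoeffN mcoeff_varM insert_mode_at eqxx.
by rewrite oppr0 mulr0 rmorph0 mul0r.
Qed.

(** One more photon delays the series by one index, with first term 0, and leaves its sum
    unchanged. *)
Lemma vacuum_coeff_limit (e : C) (p : nat) a n :
  geometric_limit (fun K => \sum_(k < K) (vacuum_term k)%:C%C) e ->
  geometric_limit (fun K => \sum_(k < K) vacuum_coeff k 'X_[insert_mode j p a] n)
    (e * (a == n)%:R).
Proof.
move=> eP; elim: p => [|p IH].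
  have := geometric_limit_linear (a == n)%:R eP (geometric_limit0 R).
  rewrite addr0 mulrC; apply: eq_geometric_limit => K.
  by rewrite addr0 mulr_sumr; apply: eq_bigr => k _; rewrite vacuum_coeff_vacuum mulrC.
apply: geometric_limit_shift; apply: eq_geometric_limit IH => K.
rewrite insert_modeS mpolyXD [RHS]big_ord_recl /=.
rewrite [X in _ = X + _](_ : _ = 0) ?add0r; last first.
  by rewrite /vacuum_coeff /= mcoeff_varM insert_mode_at eqxx mulr0.
by apply: eq_bigr => k _; rewrite vacuum_coeff_varM.
Qed.

(** By linearity the exponents [p a] of mode j are forgotten; for those of a homogenization this
    undoes it. *)
Lemma displaced_vacuum_limit (e : C) (r : seq 'X_{1..m}) (c : 'X_{1..m} -> C)
    (p : 'X_{1..m} -> nat) n :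
  geometric_limit (fun K => \sum_(k < K) (vacuum_term k)%:C%C) e ->
  geometric_limit (fun K => \sum_(k < K) (k`!)%:R^-1 *
      iter k (displacement_generator j (-1))
        (amp_of (\sum_(a <- r) c a *: 'X_[insert_mode j (p a) a])) (insert_mode j 0 n))
    (e * amp_of (\sum_(a <- r) c a *: 'X_[a]) n).
Proof.
move=> eP; pose s : C := sqrtC (mnm_fact n)%:R.
have := geometric_limit_sum r (fun a => c a * s)
  (fun a => vacuum_coeff_limit (p a) a n eP).
rewrite /amp_of linear_sum /= mulr_sumr mulr_sumr.
under eq_bigr do rewrite -/s.
move=> lim.
have -> : \sum_(a <- r) e * (s * (c a *: 'X_[a])@_n) =
    \sum_(a <- r) c a * s * (e * (a == n)%:R).
  by apply: eq_bigr => a _; rewrite mcoeffZ mcoeffX; ring.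
apply: eq_geometric_limit lim => K.
under eq_bigr do rewrite mulr_sumr.
rewrite exchange_big; apply: eq_bigr => k _ /=.
rewrite iter_generator_amp_of /amp_of mnm_fact_insert_mode fact0 mul1n -/s.
rewrite !linear_sum mulrCA !mulr_sumr; apply: eq_bigr => a _.
by rewrite linearZ /= mcoeffZ /vacuum_coeff; ring.
Qed.

End Displaced.
End VacuumAmplitude.
(** * Products of linear forms *)

Section ProductOfLinearFactors.
Variables (C : closedFieldType) (A : comAlgType C).

(** Coefficient i is a symmetric function of the roots, homogeneous of degree [size s - i]. Taking a
    in an algebra allows it to be a linear form. *)
Lemma coef_prod_scaled_XsubC (s : seq C) (a : A) i : (i <= size s)%N ->
  (\prod_(z <- s) ('X - (z *: a)%:P))`_i =
  (\prod_(z <- s) ('X - z%:P))`_i *: a ^+ (size s - i).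
Proof.
elim: s i => [|z s IH] i /=.
  rewrite leqn0 => /eqP ->; rewrite !big_nil subnn expr0.
  by rewrite !coef1 scale1r.
rewrite !big_cons => ilt; rewrite !mulrBl !coefB !coefCM !coefXM.
have [->|i0] := eqVneq i 0%N.
  rewrite !sub0r IH // subn0 subn0 exprS scaleNr; congr (- _).
  by rewrite -scalerAl -scalerAr scalerA.
have iE : i = i.-1.+1 by rewrite prednK // lt0n.
have -> : ((size s).+1 - i = size s - i.-1)%N by rewrite {1}iE subSS.
rewrite IH; last by rewrite -ltnS -iE.
rewrite scalerBl; congr (_ - _).
have [is_|is_] := leqP i (size s).
  rewrite IH // -scalerAl -scalerAr scalerA; congr (_ *: _).
  by rewrite -exprS; congr (_ ^+ _); lia.
by rewrite !nth_default ?size_prod_XsubC // ?mulr0 ?scale0r //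
  (leq_trans _ is_) // size_prod_XsubC.
Qed.

Lemma prod_XnD_factor d : (0 < d)%N -> exists2 s : seq C, size s = d &
  forall a : A, \prod_(z <- s) ('X - (z *: a)%:P) = 'X^d + (a ^+ d)%:P.
Proof.
move=> d0; have [s sE] := closed_field_poly_normal ('X^d - (-1)%:P : {poly C}).
rewrite lead_coefXnsubC // scale1r in sE.
have sd : size s = d.
  by have := congr1 (fun p : {poly C} => size p) sE; rewrite size_XnsubC // size_prod_XsubC => -[].
exists s => // a; apply/polyP => i; rewrite coefD coefXn coefC.
have [id|di] := leqP i d; last first.
  rewrite nth_default; last by rewrite size_prod_XsubC sd.
  by rewrite gtn_eqF // gtn_eqF ?addr0 // (leq_trans _ di).
rewrite coef_prod_scaled_XsubC ?sd // -sE coefB coefXn coefC.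
have [->|i_d] := eqVneq i d.
  by rewrite gtn_eqF // subr0 addr0 subnn expr0 scale1r.
have [->|i0] := eqVneq i 0%N; first by rewrite sub0r opprK scale1r subn0 add0r.
by rewrite subr0 scale0r addr0.
Qed.

End ProductOfLinearFactors.

(** As a polynomial in ['X^d], the product has roots [- c k], and its subleading coefficient is
    minus their sum. *)
Lemma coef_prod_XnD (A : idomainType) d r (c : 'I_r -> A) : (0 < d)%N -> (0 < r)%N ->
  (\prod_(k < r) ('X^d + (c k)%:P))`_(d * (r - 1)) = \sum_(k < r) c k.
Proof.
move=> d0 r0.
have -> : \prod_(k < r) ('X^d + (c k)%:P) = (\prod_(k < r) ('X - (- c k)%:P)) \Po 'X^d.
  rewrite rmorph_prod; apply: eq_bigr => k _ /=.
  by rewrite polyCN opprK comp_polyD comp_polyX comp_polyC.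
rewrite coef_comp_poly_Xn // dvdn_mulr // mulKn // subn1.
pose ps := [seq - c k | k <- enum 'I_r].
have sp : size ps = r by rewrite size_map size_enum_ord.
have := coefPn_prod_XsubC (ps := ps); rewrite sp => /(_ (lt0n_neq0 r0)).
rewrite /ps !big_map.
by rewrite -!enumT !big_enum /= sumrN opprK.
Qed.

(** * Polynomials in one distinguished mode *)

Section ModeExtraction.
Variables (C : comNzRingType) (m : nat) (j : 'I_m.+1).

Definition mode_var (i : 'I_m.+1) : {poly {mpoly C[m]}} :=
  if unlift j i is Some i' then ('X_i')%:P else 'X.

(** Projecting mode j onto k photons becomes taking coefficient k, so univariate factorizations
    apply. *)
Definition mode_poly (p : {mpoly C[m.+1]}) : {poly {mpoly C[m]}} :=
  mmap (polyC \o @mpolyC m C) mode_var p.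
HB.instance Definition _ := GRing.RMorphism.copy mode_poly
  (mmap (polyC \o @mpolyC m C) mode_var).

Lemma mode_polyZ c p : mode_poly (c *: p) = (c%:MP)%:P * mode_poly p.
Proof. by rewrite /mode_poly mmapZ. Qed.

Lemma mode_poly_var i : mode_poly 'X_i = mode_var i.
Proof. by rewrite /mode_poly mmapX mmap1U. Qed.

Lemma mode_polyX n : mode_poly 'X_[n] = 'X^(n j) * ('X_[remove_mode j n])%:P.
Proof.
rewrite /mode_poly mmapX /mmap1 (bigD1_ord j) //= /mode_var unlift_none; congr (_ * _).
rewrite mpolyXE_id rmorph_prod; apply: eq_bigr => i _.
by rewrite liftK mnmE rmorphXn.
Qed.

Lemma coef_mode_poly p k n :
  ((mode_poly p)`_k)@_n = p@_(insert_mode j k n).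
Proof.
rewrite [p]mpolyE rmorph_sum coef_sum !linear_sum; apply: eq_bigr => a _ /=.
rewrite mode_polyZ coefCM mode_polyX coefMC coefXn !mcoeffZ mcoeffX.
have -> : (a == insert_mode j k n) = (a j == k) && (remove_mode j a == n).
  by rewrite -{1}(remove_modeK j a) insert_mode_eq.
rewrite mcoeffCM [k == _]eq_sym.
case: (a j == k); last by rewrite mul0r mcoeff0.
by rewrite mul1r mcoeffX.
Qed.

Lemma mode_poly_linear_form (v : 'I_m.+1 -> C) :
  mode_poly (\sum_i v i *: 'X_i) =
  (v j)%:MP%:P * 'X + (\sum_(i < m) v (lift j i) *: 'X_i)%:P.
Proof.
rewrite rmorph_sum (bigD1_ord j) //= mode_polyZ mode_poly_var /mode_var unlift_none.
congr (_ + _); rewrite rmorph_sum; apply: eq_bigr => i _ /=.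
by rewrite mode_polyZ mode_poly_var /mode_var liftK -polyCM mul_mpolyC.
Qed.

End ModeExtraction.
Section PreparationOfProducts.
Variables (R : realType) (m : nat).
Local Notation C := R[i].

Lemma unitary_first_column (v : 'rV[C]_m.+1) : v != 0 ->
  exists W : 'M[C]_m.+1, W \is unitarymx /\
    exists2 c : C, c != 0 & forall k, v ord0 k = c * W k ord0.
Proof.
(* All rows are v, but only the first matters: Gram-Schmidt keeps its span and returns a unitary
   matrix even for dependent rows. *)
move=> v0; pose A : 'M[C]_m.+1 := \matrix_(i, k) v ord0 k.
have /sub_rVP[c vc] : (v <= row ord0 (schmidt A))%MS.
  have -> : v = row ord0 A by apply/rowP => k; rewrite !mxE.
  apply: submx_trans (row_schmidt_sub _ _) _; apply/sumsmx_subP => k.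
  by rewrite leqn0 => /eqP k0; rewrite genmxE (_ : k = ord0) //; apply: val_inj.
exists (schmidt A)^T; rewrite trmx_unitary schmidt_unitarymx //; split=> //.
exists c => [|k]; last by rewrite vc !mxE.
by apply: contraNneq v0 => c0; rewrite vc c0 scale0r.
Qed.

(* W l maps the first variable to the l-th factor; the interferometer applied
   after the l-th addition is W (l + 1)^-1 W l, so that the product telescopes. *)
Lemma prepare_product (s : seq 'rV[C]_m.+1) : (forall v, v \in s -> v != 0) ->
  exists U : nat -> amp R m.+1 -> amp R m.+1,
    (forall k, interferometer (U k)) /\
    exists2 c : C, c != 0 &
      alternate (fun=> ord0) U (size s) (vacuum R m.+1) =
      amp_of (c *: \prod_(v <- s) \sum_k v ord0 k *: 'X_k).
Proof.
move=> s0; pose lin (v : 'rV[C]_m.+1) : {mpoly C[m.+1]} := \sum_k v ord0 k *: 'X_k.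
(* The identity past the end of s makes the last interferometer return to the original modes. *)
have Wex l : exists W : 'M[C]_m.+1, W \is unitarymx /\
    if (l < size s)%N then exists2 c : C, c != 0 &
      lin (nth 0 s l) = c *: ('X_ord0 \mPo linear_forms W)
    else W = 1%:M.
  case: ltnP => ls; last by exists 1%:M; split=> //; apply/unitarymxP; rewrite trmx1 map_mx1 mulmx1.
  have [W [Wu [c c0 cW]]] := unitary_first_column (s0 _ (mem_nth 0 ls)).
  exists W; split=> //; exists c => //.
  rewrite linear_subst_var scaler_sumr; apply: eq_bigr => k _.
  by rewrite cW scalerA.
have [W WP] := choice Wex.
pose V l := (W l.+1)^t*%sesqui *m W l.
have Vu l : V l \is unitarymx.
  by apply: mul_unitarymx; rewrite ?trmxC_unitary; apply: (proj1 (WP _)).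
exists (fun l => second_quantization (V l)); split.
  by move=> k; apply: second_quantization_interferometer.
pose P k := \prod_(l < k) ('X_ord0 \mPo linear_forms (W l)).
(* The state is kept in the frame where the next factor is the first variable; [W k] returns to the
   original one. *)
have altE k : exists2 p, alternate (fun=> ord0) (fun l => second_quantization (V l)) k
    (vacuum R m.+1) = amp_of p & p \mPo linear_forms (W k) = P k.
  elim: k => [|k [p pE pP]] /=.
    by exists 1; [rewrite vacuumE|rewrite rmorph1 /P big_ord0].
  exists (('X_ord0 * p) \mPo linear_forms (V k)).
    by rewrite pE creation_amp_of second_quantization_amp_of.
  rewrite linear_substM mulmxA (unitarymxP _) ?mul1mx; last by case: (WP k.+1).
  by rewrite rmorphM /= pP /P big_ord_recr mulrC.
have [p pE] := altE (size s).
have [_] := WP (size s); rewrite ltnn => ->; rewrite linear_subst1 => pP.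
have [c c0 cP] : exists2 c : C, c != 0 & \prod_(v <- s) lin v = c *: P (size s).
  rewrite (big_nth 0) big_mkord /P.
  have : forall l : 'I_(size s), exists c : C, c != 0 /\
      lin (nth 0 s l) = c *: ('X_ord0 \mPo linear_forms (W l)).
    by move=> l; have [_] := WP l; rewrite ltn_ord => -[c]; exists c.
  move=> /choice[c cP]; exists (\prod_l c l).
    by apply/prodf_neq0 => l _; have [] := cP l.
  by rewrite -scaler_prod; apply: eq_bigr => l _; have [] := cP l.
exists c^-1; first by rewrite invr_eq0.
by rewrite pE pP cP scalerA mulVf // scale1r.
Qed.

End PreparationOfProducts.

(** * Stellar polynomials and their homogenizations *)

Section StellarPolynomials.
Variables (R : realType) (m : nat).
Local Notation C := R[i].

Lemma mcoeff_stellar (psi : amp R m) n : core_state psi ->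
  (stellar psi)@_n = psi n / sqrtC (mnm_fact n)%:R.
Proof.
move=> [fin _]; rewrite /stellar.
rewrite (fsbigTE (fset_set [set n | psi n != 0]%classic)); last first.
  move=> i; rewrite in_fset_set // notin_setE /= => /negP; rewrite negbK => /eqP->.
  by rewrite mul0r scale0r.
rewrite linear_sum /=.
under eq_bigr do rewrite mcoeffZ mcoeffX.
have [n0|n0] := eqVneq (psi n) 0.
  rewrite n0 mul0r big1 // => i _.
  by case: eqP => [->|_]; rewrite ?n0 ?mul0r ?mulr0.
rewrite (bigD1_seq n) ?finmap.fset_uniq //=; last first.
  by rewrite in_fset_set //; apply/mem_set.
by rewrite eqxx mulr1 big1 ?addr0 // => i /negbTE->; rewrite mulr0.
Qed.

Lemma amp_of_stellar (psi : amp R m) : core_state psi -> amp_of (stellar psi) = psi.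
Proof.
move=> core; apply/funext => n.
by rewrite /amp_of mcoeff_stellar // mulrC divfK // sqrtC_fact_neq0.
Qed.

Lemma mcoeff_homogenization (P : {mpoly C[m]}) p n :
  (homogenization P)@_(insert_mode ord0 p n) =
  if p == ((msize P).-1 - mdeg n)%N then P@_n else 0.
Proof.
rewrite /homogenization linear_sum /=.
have [->|ne] := eqVneq p.
  rewrite [in RHS](mpolyE P) linear_sum /=.
  by apply: eq_bigr => a _; rewrite !mcoeffZ !mcoeffX insert_mode_eq andb_idl // => /eqP->.
rewrite big1 // => a _; rewrite mcoeffZ mcoeffX insert_mode_eq.
case: (a =P n) => [->|_]; last by rewrite andbF mulr0.
by rewrite eq_sym (negbTE ne) mulr0.
Qed.

(** An empty sum would lose the leading coefficient of P. Positivity matters because [r - 1] is a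
    truncated subtraction. *)
Lemma waring_rank_gt0 (P : {mpoly C[m]}) d r : P != 0 ->
  waring_decomposable d (homogenization P) r -> (0 < r)%N.
Proof.
move=> P0 [w wP]; case: r w wP => // w; rewrite big_ord0 => hP.
have : mlead P \in msupp P by apply: mlead_supp.
rewrite mcoeff_msupp => /eqP[].
have := mcoeff_homogenization P ((msize P).-1 - mdeg (mlead P)) (mlead P).
by rewrite eqxx hP mcoeff0 => <-.
Qed.

(** No power of y occurs when all monomials have degree d, so the second ancilla is left in the
    vacuum. *)
Lemma homogenization_homog (psi : amp R m) d : core_state psi ->
  msize (stellar psi) = d.+1 -> stellar psi \is d.-homog ->
  amp_of (homogenization (stellar psi)) = adjoin_vacuum ord0 psi.
Proof.
move=> core deg hom; apply/funext => n.
rewrite /amp_of /adjoin_vacuum -(remove_modeK ord0 n) mcoeff_homogenization deg /=.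
rewrite insert_modeK !insert_mode_at.
have [P0|P0] := eqVneq ((stellar psi)@_(remove_mode ord0 n)) 0.
  have psi0 : psi (remove_mode ord0 n) = 0.
    by rewrite -(amp_of_stellar core) /amp_of P0 mulr0.
  by rewrite P0 psi0 !if_same mulr0.
have -> : mdeg (remove_mode ord0 n) = d.
  by apply: (dhomog_mf hom); rewrite mcoeff_msupp.
rewrite subnn; case: eqP => [->|_]; last by rewrite mulr0.
rewrite mnm_fact_insert_mode fact0 mul1n.
by rewrite -{2}(amp_of_stellar core).
Qed.

End StellarPolynomials.
Lemma prepare_waring (R : realType) (M d r : nat) (P : {mpoly R[i][M.+1]}) :
  (0 < d)%N -> (0 < r)%N -> waring_decomposable d P r ->
  exists U : nat -> amp R M.+2 -> amp R M.+2,
  (forall k, interferometer (U k)) /\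
  exists2 c : R[i], c != 0 &
    project ord0 (d * (r - 1)) (alternate (fun=> ord0) U (d * r) (vacuum R M.+2)) =
    amp_of (c *: P).
Proof.
move=> d_gt0 r_gt0 [w wP].
have [zs zs_size zsP] := @prod_XnD_factor R[i] {mpoly R[i][M.+1]} d d_gt0.
(* The coefficients of X_0 - z L_k; the entry 1 on mode 0 makes every factor nonzero. *)
pose v k z : 'rV[R[i]]_M.+2 :=
  \row_i if unlift ord0 i is Some i' then - (z * w k i') else 1.
pose s := [seq v k z | k <- enum 'I_r, z <- zs].
have s_size : size s = (d * r)%N by rewrite size_allpairs size_enum_ord zs_size mulnC.
have [x|U [Ui [c c0 cE]]] := @prepare_product R M.+1 s.
  move=> /allpairsP[[k z] /= [_ _ ->]]; apply/eqP => /rowP/(_ ord0).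
  by rewrite !mxE unlift_none => /eqP; rewrite oner_eq0.
exists U; split=> //; set p := (d * (r - 1))%N.
(* The square root is the normalization of the Fock state onto which mode 0 is projected. *)
exists (sqrtC p`!%:R * c).
  by rewrite mulf_neq0 // sqrtC_eq0 pnatr_eq0 -lt0n fact_gt0.
apply/funext => n; rewrite -s_size cE /project /amp_of mnm_fact_insert_mode.
rewrite natrM rootCMl ?ler0n // !mcoeffZ -coef_mode_poly.
suff -> : (mode_poly ord0 (\prod_(x <- s) \sum_k x ord0 k *: 'X_k))`_p = P.
  by ring.
have factor k : \prod_(z <- zs) mode_poly ord0 (\sum_i v k z ord0 i *: 'X_i) =
    'X^d + ((\sum_i w k i *: 'X_i) ^+ d)%:P.
  rewrite -zsP; apply: eq_bigr => z _.
  rewrite mode_poly_linear_form mxE unlift_none mpolyC1 polyC1 mul1r.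
  congr (_ + _); rewrite -polyCN; congr (_%:P).
  rewrite scaler_sumr -sumrN; apply: eq_bigr => i _.
  by rewrite mxE liftK scaleNr scalerA.
rewrite rmorph_prod /s big_allpairs_dep /= wP.
under eq_bigr do rewrite factor.
by rewrite big_enum /= (coef_prod_XnD (fun k => (\sum_i w k i *: 'X_i) ^+ d)).
Qed.

(* In 'I_M.+2, mode 0 is the first ancilla, mode 1 the second ancilla, and the
   others are the target modes; once mode 0 has been projected out, the second
   ancilla is mode 0 of 'I_M.+1. *)
Theorem theorem1 (R : realType) (d M r : nat) (psi : amp R M)
    (d_ge1 : (1 <= d)%N) (M_ge1 : (1 <= M)%N)
    (psi_core : core_state psi)
    (psi_photons : forall n : 'X_{1..M}, psi n != 0 -> (mdeg n <= d)%N)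
    (psi_degree : msize (stellar psi) = d.+1)
    (r_rank : is_waring_rank d (homogenization (stellar psi)) r) :
  exists (j : nat -> 'I_M.+2) (U : nat -> amp R M.+2 -> amp R M.+2),
    (forall k : nat, (k < d * r)%N -> interferometer (U k)) /\
    let phi : amp R M.+1 :=
      project ord0 (d * (r - 1)) (alternate j U (d * r) (vacuum R M.+2)) in
    (stellar psi \is d.-homog -> proportional phi (adjoin_vacuum ord0 psi)) /\
    (stellar psi \isn't d.-homog ->
       exists (beta : R[i]) (chi : amp R M.+1),
         is_displaced ord0 beta phi chi /\
         proportional (project ord0 0 chi) psi).
Proof.
have [waring _] := r_rank.
have P0 : stellar psi != 0 by rewrite -msize_poly_eq0 psi_degree.
have [U [Ui [c c0 phiE]]] := prepare_waring d_ge1 (waring_rank_gt0 P0 waring) waring.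
exists (fun=> ord0), U; split=> [k _ //|] phi; split=> [hom|_].
  exists c => // n; rewrite /phi phiE amp_of_scale.
  by rewrite (homogenization_homog psi_core psi_degree hom).
have [D phiD] : exists D, forall n, (D < mdeg n)%N -> phi n = 0.
  exists (msize (c *: homogenization (stellar psi))) => n nD.
  rewrite /phi phiE /amp_of memN_msupp_eq0 ?mulr0 //.
  by apply: contraL nD => /msize_mdeg_lt /ltnW; rewrite -leqNgt.
have [b wb] := finite_weighted_bound phiD.
have [chi chiP chi_lim] := displacement_exists ord0 wb.
exists (-1), chi; split=> //.
have [e e0 eP] := vacuum_amplitude R.
have cQ : c *: homogenization (stellar psi) = \sum_(a <- msupp (stellar psi))
    (c * (stellar psi)@_a) *:
      'X_[insert_mode ord0 ((msize (stellar psi)).-1 - mdeg a) a].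
  by rewrite scaler_sumr; apply: eq_bigr => a _; rewrite scalerA.
(* The vacuum amplitude of the displacement times the scalar left by the preparation. *)
exists (e%:C%C * c) => [|n].
  by rewrite mulf_neq0 // (inj_eq (@complexI R) e 0).
rewrite -[in RHS](amp_of_stellar psi_core) -mulrA -amp_of_scale.
have := displaced_vacuum_limit ord0 (msupp (stellar psi))
  (fun a => c * (stellar psi)@_a) (fun a => ((msize (stellar psi)).-1 - mdeg a)%N) n eP.
rewrite -cQ -phiE => lim; rewrite /project (geometric_limit_unique (chi_lim _) lim).
rewrite [in RHS](mpolyE (stellar psi)) scaler_sumr.
by under [in RHS]eq_bigr do rewrite scalerA.
Qed.
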